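(* Let $x_1,x_2$ be two operationally holonomic signals with $x_1x_2\neq0$, let $\varpi_1\in k_0(s)[\frac{d}{ds}]$ be a minimal annihilator of $x_1$, let $X=x_1+x_2e^{-t_rs}$, and let $\varpi_2'\in k_0(s)[\frac{d}{ds}]$ be a minimal annihilator of $\varpi_1x_2$. Then the equation $$\varpi_2'\bigl((\varpi_1X)\,e^{t_rs}\bigr)=0$$ is equivalent to an equation of the form $$\sum_{\text{finite}}t_r^{\nu}\,(\pi_\nu X)=0,\qquad \pi_\nu\in k_0(s)\left[\frac{d}{ds}\right],$$ where at least one $\pi_\nu$ is not equal to $0$.
   Context: $k_0$ is a commutative field of characteristic zero, and $k_0(s)$ is a differential field for $\frac{d}{ds}$ with field of constants $k_0$. $k_0(s)[\frac{d}{ds}]$ is the noncommutative ring of linear differential operators $\sum_{\text{finite}}\varrho_\alpha\frac{d^\alpha}{ds^\alpha}$, $\varrho_\alpha\in k_0(s)$. $k/k_0$ is a transcendental field extension; elements of $k$ are constants for $\frac{d}{ds}$ on $k(s)$. The delay $t_r\in k$ is transcendental over $k_0$. A signal $x$ is operationally holonomic if $\varpi x=0$ for some nonzero $\varpi\in k_0(s)[\frac{d}{ds}]$. Let $\bar K$ be the algebraic closure of $k_0(s)$, a differential field with field of constants the algebraic closure $\bar k_0$ of $k_0$; the signals are elements of a Picard–Vessiot extension $E$ of $\bar K$ (so $E$ has constants $\bar k_0$). All computations take place in a differential field containing $E$, $k(s)$ and the delay operator $e^{-t_rs}$, which is a nonzero element satisfying $\left(\frac{d}{ds}+t_r\right)e^{-t_rs}=0$;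 $e^{t_rs}$ is its inverse. The annihilator of a signal $x$ is the left ideal of all $\varpi\in k_0(s)[\frac{d}{ds}]$ with $\varpi x=0$; it is principal, and a minimal annihilator of $x$ is a (nonzero) generator of it. *)

(* Defs.v *)
From HB Require Import structures.
From mathcomp Require Import all_boot all_algebra.
From mathcomp Require Import generic_quotient ring.

Set Implicit Arguments.
Unset Strict Implicit.
Unset Printing Implicit Defensive.

Import GRing.Theory.
Local Open Scope ring_scope.
Local Open Scope quotient_scope.

Notation "x %:F" := (@FracField.tofrac _ x) : ring_scope.

HB.mixin Record Field_isDifferential K of GRing.Field K := {
  der : K -> K;
  derD : {morph der : x y / x + y};
  derM : forall x y, der (x * y) = der x * y + x * der y
}.

#[short(type="diffFieldType")]
HB.structure Definition DiffField := {K of GRing.Field K & Field_isDifferential K}.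

Definition differential (K L : diffFieldType) (f : K -> L) : Prop :=
  forall x, f (der x) = der (f x).

Section DerTheory.
Variable K : diffFieldType.
Implicit Types x y : K.

Lemma der0 : der 0 = 0 :> K.
Proof. by apply: (addIr (der 0)); rewrite -derD addr0 add0r. Qed.

Lemma der1 : der 1 = 0 :> K.
Proof.
apply: (addIr (der 1)); rewrite add0r.
by have := derM (1 : K) 1; rewrite !mul1r mulr1.
Qed.

Lemma derN x : der (- x) = - der x.
Proof. by apply: (addIr (der x)); rewrite -derD !addNr der0. Qed.

Lemma der_sum (I : Type) (r : seq I) (P : pred I) (G : I -> K) :
  der (\sum_(i <- r | P i) G i) = \sum_(i <- r | P i) der (G i).
Proof. exact: (big_morph _ (@derD K) der0). Qed.

End DerTheory.

Lemma quotient_rule_wd (K : fieldType) (p q n d p' q' n' d' : K) :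
  q != 0 -> d != 0 -> p / q = n / d ->
  p' * d + p * d' = n' * q + n * q' ->
  (n' * d - n * d') / d ^+ 2 = (p' * q - p * q') / q ^+ 2.
Proof.
move=> q0 d0 /eqP; rewrite eqr_div // => /eqP pd H.
apply/eqP; rewrite eqr_div ?expf_neq0 // -subr_eq0; apply/eqP.
transitivity (- (q * d) * ((p' * d + p * d') - (n' * q + n * q'))
     + (p * d - n * q) * (q' * d + q * d')); first by ring.
by rewrite H pd !subrr mulr0 mul0r addr0.
Qed.

Lemma quotient_ruleD (K : fieldType) (a b c d a' b' c' d' : K) :
  b != 0 -> d != 0 ->
  ((a' * d + a * d' + (c' * b + c * b')) * (b * d)
      - (a * d + c * b) * (b' * d + b * d')) / (b * d) ^+ 2
  = (a' * b - a * b') / b ^+ 2 + (c' * d - c * d') / d ^+ 2.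
Proof. by move=> b0 d0; field; rewrite b0 d0. Qed.

Lemma quotient_ruleM (K : fieldType) (a b c d a' b' c' d' : K) :
  b != 0 -> d != 0 ->
  ((a' * c + a * c') * (b * d) - (a * c) * (b' * d + b * d')) / (b * d) ^+ 2
  = (a' * b - a * b') / b ^+ 2 * (c / d) + a / b * ((c' * d - c * d') / d ^+ 2).
Proof. by move=> b0 d0; field; rewrite b0 d0. Qed.

Section RatDer.
Variable F : fieldType.
Implicit Types (x y : {fraction {poly F}}) (p q : {poly F}).

(* d/ds on F(s), by the quotient rule applied to a representative; [ratderE]
   shows that the choice of representative is irrelevant. *)
Definition ratder x : {fraction {poly F}} :=
  let n := \n_(repr x) in let d := \d_(repr x) in
  (n^`() * d - n * d^`())%:F / (d ^+ 2)%:F.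

Lemma fracE x : x = (\n_(repr x))%:F / (\d_(repr x))%:F.
Proof.
have d0 : (\d_(repr x))%:F != 0 :> {fraction {poly F}}.
  by rewrite tofrac_eq0 denom_ratioP.
apply: (mulIf d0); rewrite divfK //.
rewrite -{1}[x]reprK; move: (repr x) d0 => r _; unlock FracField.tofrac.
rewrite -[LHS]FracField.pi_mul; apply/eqmodP.
rewrite /= FracField.equivfE /FracField.mulf /= !numden_Ratio ?oner_neq0 //.
  by rewrite !mulr1 mulrC.
all: by rewrite mulr1 denom_ratioP.
Qed.

Lemma ratderE p q : q != 0 ->
  ratder (p%:F / q%:F) = (p^`() * q - p * q^`())%:F / (q ^+ 2)%:F.
Proof.
move=> q0; rewrite /ratder; have := fracE (p%:F / q%:F).
move: (\n_(repr _)) (\d_(repr _)) (denom_ratioP (repr (p%:F / q%:F))) => n d d0.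
have Fd0 : d%:F != 0 :> {fraction {poly F}} by rewrite tofrac_eq0.
have Fq0 : q%:F != 0 :> {fraction {poly F}} by rewrite tofrac_eq0.
move=> pq_nd; have pd_nq : p * d = n * q.
  apply/eqP; rewrite -tofrac_eq [(p * d)%:F]tofracM [(n * q)%:F]tofracM.
  by rewrite -(eqr_div _ _ Fq0 Fd0); apply/eqP.
rewrite !tofracXn !tofracB !tofracM.
apply: (quotient_rule_wd Fq0 Fd0 pq_nd).
have := congr1 (fun r => (deriv r)%:F) pd_nq.
by rewrite /= !derivM !tofracD !tofracM.
Qed.

Lemma ratder_poly p : ratder p%:F = (p^`())%:F.
Proof.
have -> : p%:F = p%:F / (1 : {poly F})%:F by rewrite tofrac1 divr1.
rewrite ratderE ?oner_neq0 // derivC mulr0 subr0 mulr1 expr1n.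
by rewrite tofrac1 divr1.
Qed.

Lemma ratderD : {morph ratder : x y / x + y}.
Proof.
move=> x y; rewrite (fracE x) (fracE y).
move: (\n_(repr x)) (\d_(repr x)) (denom_ratioP (repr x)) => a b b0.
move: (\n_(repr y)) (\d_(repr y)) (denom_ratioP (repr y)) => c d d0.
have Fb0 : b%:F != 0 :> {fraction {poly F}} by rewrite tofrac_eq0.
have Fd0 : d%:F != 0 :> {fraction {poly F}} by rewrite tofrac_eq0.
have -> : a%:F / b%:F + c%:F / d%:F = (a * d + c * b)%:F / (b * d)%:F.
  by rewrite (addf_div _ _ Fb0 Fd0) tofracD !tofracM.
rewrite (ratderE _ b0) (ratderE _ d0) (ratderE _ (mulf_neq0 b0 d0)) derivD !derivM.
rewrite !tofracXn !tofracB !tofracM !tofracD !tofracM.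
exact (@quotient_ruleD {fraction {poly F}} _ _ _ _ _ _ _ _ Fb0 Fd0).
Qed.

Lemma ratderM x y : ratder (x * y) = ratder x * y + x * ratder y.
Proof.
rewrite (fracE x) (fracE y).
move: (\n_(repr x)) (\d_(repr x)) (denom_ratioP (repr x)) => a b b0.
move: (\n_(repr y)) (\d_(repr y)) (denom_ratioP (repr y)) => c d d0.
have Fb0 : b%:F != 0 :> {fraction {poly F}} by rewrite tofrac_eq0.
have Fd0 : d%:F != 0 :> {fraction {poly F}} by rewrite tofrac_eq0.
have -> : a%:F / b%:F * (c%:F / d%:F) = (a * c)%:F / (b * d)%:F.
  by rewrite mulf_div !tofracM.
rewrite (ratderE _ b0) (ratderE _ d0) (ratderE _ (mulf_neq0 b0 d0)) !derivM.
rewrite !tofracXn !tofracB !tofracM !tofracD !tofracM.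
exact (@quotient_ruleM {fraction {poly F}} _ _ _ _ _ _ _ _ Fb0 Fd0).
Qed.

HB.instance Definition _ :=
  Field_isDifferential.Build {fraction {poly F}} ratderD ratderM.

End RatDer.

(* The Ore ring K[d/ds]: the operator \sum_i w_i (d/ds)^i is stored as the
   polynomial with coefficients w_i, but under the product determined by
   (d/ds) a = a (d/ds) + der a. *)
Definition diffop (K : diffFieldType) := {poly K}.
Definition diffop_poly (K : diffFieldType) (w : diffop K) : {poly K} := w.
Coercion diffop_poly : diffop >-> polynomial.

HB.instance Definition _ (K : diffFieldType) :=
  GRing.Zmodule.copy (diffop K) {poly K}.

Section DiffOp.
Variable K : diffFieldType.
Implicit Types (u v w : {poly K}) (a b : K).

(* left multiplication by d/ds *)
Definition dmul w : {poly K} := w * 'X + \poly_(i < size w) der w`_i.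

Definition opmul u v : {poly K} := \sum_(i < size u) u`_i *: iter i dmul v.

Arguments dmul : simpl never.

Lemma coef_dmul w i : (dmul w)`_i = (w * 'X)`_i + der w`_i.
Proof.
rewrite coefD coef_poly; case: ltnP => // le_w_i.
by rewrite (nth_default _ le_w_i) der0.
Qed.

Lemma dmulD : {morph dmul : u v / u + v}.
Proof.
move=> u v; apply/polyP=> i.
by rewrite coefD !coef_dmul mulrDl !coefD derD addrACA.
Qed.

Lemma dmul0 : dmul 0 = 0.
Proof. by apply/polyP=> i; rewrite coef_dmul mul0r coef0 der0 addr0. Qed.

Lemma dmulZ a w : dmul (a *: w) = der a *: w + a *: dmul w.
Proof.
apply/polyP=> i; rewrite coef_dmul [RHS]coefD !coefZ coef_dmul -scalerAl coefZ derM.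
by rewrite mulrDr addrCA.
Qed.

Lemma iter_dmulD i : {morph iter i dmul : u v / u + v}.
Proof. by elim: i => [|i IHi] u v; rewrite // !iterS IHi dmulD. Qed.

Lemma iter_dmul0 i : iter i dmul 0 = 0.
Proof. by elim: i => //= i ->; rewrite dmul0. Qed.

Lemma iter_dmul1 i : iter i dmul 1 = 'X^i.
Proof.
elim: i => [|i IHi] /=; first by rewrite expr0.
rewrite IHi; apply/polyP=> j.
rewrite coef_dmul -exprSr !coefXn; case: (j == i); last by rewrite der0 addr0.
by rewrite der1 addr0.
Qed.

Lemma opmul_wide n u v : (size u <= n)%N ->
  opmul u v = \sum_(i < n) u`_i *: iter i dmul v.
Proof.
move=> le_u_n; rewrite /opmul (big_ord_widen n (fun i => u`_i *: iter i dmul v)) //.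
rewrite big_mkcond /=; apply: eq_bigr => i _; case: ltnP => // le_u_i.
by rewrite nth_default // scale0r.
Qed.

Lemma opmulDl : left_distributive opmul +%R.
Proof.
move=> u v w; pose n := maxn (size u) (size v).
rewrite !(@opmul_wide n) ?leq_maxl ?leq_maxr ?size_polyD // -big_split.
by apply: eq_bigr => i _; rewrite coefD scalerDl.
Qed.

Lemma opmulDr : right_distributive opmul +%R.
Proof.
move=> w u v; rewrite /opmul -big_split.
by apply: eq_bigr => i _; rewrite iter_dmulD scalerDr.
Qed.

Lemma op0mul v : opmul 0 v = 0.
Proof. by rewrite /opmul size_poly0 big_ord0. Qed.

Lemma opmulZ a u v : opmul (a *: u) v = a *: opmul u v.
Proof.
rewrite (@opmul_wide (size u)) ?size_scale_leq // scaler_sumr.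
by apply: eq_bigr => i _; rewrite coefZ scalerA.
Qed.

Lemma opmul_sum n (G : nat -> {poly K}) v :
  opmul (\sum_(i < n) G i) v = \sum_(i < n) opmul (G i) v.
Proof.
elim: n => [|n IHn]; first by rewrite !big_ord0 op0mul.
by rewrite !big_ord_recr /= opmulDl IHn.
Qed.

Lemma dmul_opmul u v : dmul (opmul u v) = opmul (dmul u) v.
Proof.
have le_du : (size (dmul u) <= (size u).+1)%N.
  apply/leq_sizeP=> j ltuj; rewrite coef_dmul coefMX.
  rewrite !nth_default ?der0 ?addr0 ?if_same //; first exact: ltnW.
  by case: j ltuj.
rewrite (opmul_wide _ le_du).
under [RHS]eq_bigr => i _ do rewrite coef_dmul scalerDl.
rewrite big_split /= big_ord_recl coefMX scale0r add0r.
rewrite [X in _ = _ + X]big_ord_recr /= (nth_default _ (leqnn _)) der0 scale0r addr0.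
rewrite /opmul (big_morph _ dmulD dmul0) -big_split /=.
by apply: eq_bigr => i _; rewrite dmulZ coefMX /= addrC.
Qed.

Lemma opmulA : associative opmul.
Proof.
move=> u v w; have Eiter i : iter i dmul (opmul v w) = opmul (iter i dmul v) w.
  by elim: i => //= i ->; rewrite dmul_opmul.
rewrite {2}/opmul (opmul_sum _ (fun i => u`_i *: iter i dmul v)).
by apply: eq_bigr => i _; rewrite opmulZ Eiter.
Qed.

Lemma op1mul : left_id 1 opmul.
Proof. by move=> v; rewrite /opmul size_poly1 big_ord1 coef1 scale1r. Qed.

Lemma opmul1 : right_id 1 opmul.
Proof.
move=> u; rewrite /opmul -[RHS]coefK poly_def.
by apply: eq_bigr => i _; rewrite iter_dmul1.
Qed.

End DiffOp.

HB.instance Definition _ (K : diffFieldType) :=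
  GRing.Zmodule_isNzRing.Build (diffop K) (@opmulA K) (@op1mul K) (@opmul1 K)
    (@opmulDl K) (@opmulDr K) (oner_neq0 {poly K}).

Section Action.
Variables (K L : diffFieldType) (f : K -> L).
Implicit Types (u v w : diffop K) (x y : L).

(* the action of K[d/ds] on a differential extension f : K -> L *)
Definition opapp w x : L := \sum_(i < size w) f w`_i * iter i der x.

Definition holonomic x : Prop := exists2 w, w != 0 & opapp w x = 0.

Definition min_annihilator w x : Prop :=
  w != 0 /\ forall v, opapp v x = 0 <-> exists u, v = u * w.

End Action.

Section ActionTheory.
Variables (K L : diffFieldType) (f : {rmorphism K -> L}).
Implicit Types (u v w : diffop K) (x y : L).

Lemma opapp_wide n w x : (size w <= n)%N ->
  opapp f w x = \sum_(i < n) f w`_i * iter i der x.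
Proof.
move=> le_w_n; rewrite /opapp (big_ord_widen n (fun i => f w`_i * iter i der x)) //.
rewrite big_mkcond /=; apply: eq_bigr => i _; case: ltnP => // le_w_i.
by rewrite nth_default // rmorph0 mul0r.
Qed.

Lemma opappD u v x : opapp f (u + v) x = opapp f u x + opapp f v x.
Proof.
pose n := maxn (size u) (size v).
rewrite !(@opapp_wide n) ?leq_maxl ?leq_maxr //; last exact: size_polyD.
rewrite -big_split; apply: eq_bigr => i _.
by rewrite [(u + v : {poly K})`_i]coefD rmorphD mulrDl.
Qed.

Lemma opappZ a (w : {poly K}) x : opapp f (a *: w) x = f a * opapp f w x.
Proof.
rewrite (@opapp_wide (size w)); last exact: size_scale_leq.
rewrite mulr_sumr; apply: eq_bigr => i _.
by rewrite [(_ : {poly K})`_i]coefZ rmorphM mulrA.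
Qed.

Lemma opappM u v x : differential f ->
  opapp f (u * v) x = opapp f u (opapp f v x).
Proof.
move=> fD; have Ed w : opapp f (dmul w) x = der (opapp f w x).
  rewrite der_sum (@opapp_wide (size w).+1); last first.
    apply/leq_sizeP=> j ltuj; rewrite coef_dmul coefMX.
    rewrite !nth_default ?der0 ?addr0 ?if_same //; first exact: ltnW.
    by case: j ltuj.
  under eq_bigr => i _ do rewrite coef_dmul rmorphD mulrDl fD.
  rewrite big_split /= big_ord_recl coefMX rmorph0 mul0r add0r.
  rewrite [X in _ + X]big_ord_recr /= (nth_default _ (leqnn _)) rmorph0 der0.
  rewrite mul0r addr0 -big_split /=.
  by apply: eq_bigr => i _; rewrite derM coefMX /= addrC.
have Ei i w : opapp f (iter i (@dmul K) w) x = iter i der (opapp f w x).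
  by elim: i => //= i <-; rewrite -Ed.
suff En n : opapp f (\sum_(i < n) u`_i *: iter i (@dmul K) v) x
    = \sum_(i < n) f u`_i * iter i der (opapp f v x) by exact: En.
elim: n => [|n IHn].
  by rewrite !big_ord0 /opapp /= size_poly0 big_ord0.
by rewrite !big_ord_recr /= opappD IHn opappZ Ei.
Qed.

End ActionTheory.

(* the differential subfield of L generated by the range of f and the y_i *)
Inductive diff_adjoin (K L : diffFieldType) (f : K -> L) (n : nat)
    (y : 'I_n -> L) : L -> Prop :=
| Adjoin_base a : diff_adjoin f y (f a)
| Adjoin_gen i : diff_adjoin f y (y i)
| Adjoin_sub u v : diff_adjoin f y u -> diff_adjoin f y v ->
    diff_adjoin f y (u - v)
| Adjoin_mul u v : diff_adjoin f y u -> diff_adjoin f y v ->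
    diff_adjoin f y (u * v)
| Adjoin_inv u : diff_adjoin f y u -> diff_adjoin f y u^-1
| Adjoin_der u : diff_adjoin f y u -> diff_adjoin f y (der u).

(* f : K -> L is the Picard-Vessiot extension of an operator w of order n:
   L is generated by n solutions of w that are linearly independent over the
   constants, and has no constants other than those of K. *)
Definition picard_vessiot (K L : diffFieldType) (f : {rmorphism K -> L}) : Prop :=
  [/\ differential f,
      forall c : L, der c = 0 -> exists2 a : K, der a = 0 & c = f a &
      exists (n : nat) (w : diffop K) (y : 'I_n -> L),
        [/\ size w = n.+1,
            forall i, opapp f w (y i) = 0,
            forall c : 'I_n -> L, (forall i, der (c i) = 0) ->
              \sum_i c i * y i = 0 -> forall i, c i = 0
          & forall z, diff_adjoin f y z]].

(* f : K -> L is an algebraic closure of the differential field K, with the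
   derivation of L extending that of K. *)
Definition diff_alg_closure (K L : diffFieldType) (f : {rmorphism K -> L}) : Prop :=
  [/\ differential f, GRing.closed_field_axiom L
    & forall z, algebraicOver f z].

(* Main.v *)
Require Import Defs.
From HB Require Import structures.
From mathcomp Require Import all_boot all_algebra.

Set Implicit Arguments.
Unset Strict Implicit.
Unset Printing Implicit Defensive.

Import GRing.Theory.
Local Open Scope ring_scope.

(** Multiplication by an exponential shifts the derivation: if [t] is a constant
and [der e = t * e], then d/ds applied to [y * e] is [(d/ds + t) y * e].  Hence
an operator w(d/ds) applied to [y * e] is [e] times the shifted operator
w(d/ds + t) applied to [y], and since [t] commutes with d/ds and with the
coefficients of w, Taylor's formula expands the latter in powers of [t]:
w(d/ds + t) is the sum of the t^nu w^[nu](d/ds), where w^[nu] is the [nu]-th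
formal derivative of w in the variable d/ds, divided by nu!.

With e = e^{tr s}, w = [w2'] and y = [w1] Y, the left-hand side of the equation
is e times the sum of the t^nu (w2'^[nu] w1) Y; as e is invertible, the two
equations are equivalent with pi_nu = w2'^[nu] w1.  For nu the order of [w2'],
w2'^[nu] is the leading coefficient of [w2'], so that this pi_nu is a nonzero
multiple of [w1].

The expansion is obtained from the Leibniz rule [opapp_leibniz], valid for an
arbitrary second factor, by inserting the derivatives t^nu e of e. *)

Section LeibnizRule.
Variables (K L : diffFieldType) (f : {rmorphism K -> L}).

Lemma opapp0 x : opapp f 0 x = 0.
Proof. by rewrite (@opapp_wide _ _ f 0) ?big_ord0 // size_poly0. Qed.

Lemma opappDr w x y : opapp f w (x + y) = opapp f w x + opapp f w y.
Proof.
have iter_derD i : iter i der (x + y) = iter i der x + iter i der y.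
  by elim: i => //= i ->; rewrite derD.
by rewrite /opapp -big_split; apply: eq_bigr => i _; rewrite iter_derD mulrDr.
Qed.

(** Stored with its coefficients on the left, the operator p d/ds is the
commutative product [p * 'X]; this makes induction on polynomials available
for operators. *)
Lemma opapp_MXaddC (p : {poly K}) c x :
  opapp f (p * 'X + c%:P : {poly K}) x = opapp f p (der x) + f c * x.
Proof.
rewrite (@opapp_wide _ _ f (size p).+1); last first.
  by rewrite size_MXaddC; case: ifP.
rewrite big_ord_recl addrC coefD coefMX coefC /= add0r; congr (_ + _).
by apply: eq_bigr => i _; rewrite coefD coefMX coefC /= addr0 -iterSr.
Qed.

(** The binomial coefficients of the usual Leibniz rule are absorbed in the
divided derivatives [p^`N(i)].  Allowing any bound [n] beyond the order is what
lets the induction go through, as [p] and [p * 'X] have different orders. *)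
Lemma opapp_leibniz (n : nat) (p : {poly K}) (x y : L) : (size p <= n)%N ->
  opapp f p (x * y) = \sum_(i < n) opapp f p^`N(i) x * iter i der y.
Proof.
elim/poly_ind: p n x y => [|p c IHp] n x y.
  move=> _; rewrite opapp0 big1 // => i _.
  by rewrite nderivn_poly0 ?size_poly0 // opapp0 mul0r.
case: n => [|n le_pn].
  by rewrite leqn0 size_poly_eq0 => /eqP ->; rewrite opapp0 big_ord0.
have le_p : (size p <= n)%N.
  move: le_pn; rewrite size_MXaddC; case: ifP => // /andP[/eqP -> _] _.
  by rewrite size_poly0.
have stepE i : opapp f (p * 'X + c%:P : {poly K})^`N(i.+1) x
    = opapp f p^`N(i) x + opapp f p^`N(i.+1) (der x).
  rewrite nderivnMXaddC opappD -[_ * 'X]addr0 -(polyC0 K).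
  by rewrite opapp_MXaddC rmorph0 mul0r addr0.
rewrite opapp_MXaddC derM opappDr (IHp n.+1) ?leqW // (IHp n) //.
rewrite !big_ord_recl !nderivn0 opapp_MXaddC.
rewrite mulrDl mulrA -![LHS]addrA -[RHS]addrA; congr (_ + _).
rewrite addrA -big_split addrC; congr (_ + _); apply: eq_bigr => i _.
by rewrite /= stepE mulrDl addrC -iterSr.
Qed.

End LeibnizRule.

(** The shift p(d/ds) e = e p(d/ds + t), with p(d/ds + t) in Taylor-expanded
form.  As [t] is a constant, the [i]-th derivative of [e] is [t ^+ i * e], so
[e] factors out of the Leibniz rule. *)
Lemma opapp_mul_exp (K L : diffFieldType) (f : {rmorphism K -> L})
    (p : {poly K}) (t e y : L) : der t = 0 -> der e = t * e ->
  opapp f p (y * e) = (\sum_(i < size p) t ^+ i * opapp f p^`N(i) y) * e.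
Proof.
move=> dt de; have der_texp i : der (t ^+ i) = 0.
  elim: i => [|i IHi]; first by rewrite der1.
  by rewrite exprS derM dt IHi mul0r mulr0 addr0.
have iter_e i : iter i der e = t ^+ i * e.
  elim: i => [|i IHi]; first by rewrite mul1r.
  by rewrite iterS IHi derM der_texp mul0r add0r de exprSr mulrA.
rewrite (opapp_leibniz f _ _ (leqnn _)) mulr_suml; apply: eq_bigr => i _.
by rewrite iter_e mulrA [t ^+ i * _]mulrC.
Qed.

Lemma nderivn_order (R : nzRingType) (p : {poly R}) (n : nat) :
  size p = n.+1 -> p^`N(n) = (lead_coef p)%:P.
Proof.
move=> size_p; apply/polyP=> i; rewrite coef_nderivn coefC lead_coefE size_p /=.
case: i => [|i]; first by rewrite addn0 binn mulr1n.
by rewrite nth_default ?mul0rn // size_p addnS ltnS leq_addr.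
Qed.

Lemma opmul_polyC (K : diffFieldType) a (v : {poly K}) : opmul a%:P v = a *: v.
Proof. by rewrite (@opmul_wide _ 1) ?size_polyC_leq1 // big_ord1 coefC. Qed.

Lemma derV_exp (L : diffFieldType) (t e : L) :
  e != 0 -> der e + t * e = 0 -> der e^-1 = t * e^-1.
Proof.
move=> e0 /(canRL (addrK _)); rewrite add0r => de; apply: (mulfI e0).
have := derM e e^-1; rewrite divff // der1 de mulNr mulfK //.
by move=> /eqP; rewrite eq_sym addrC subr_eq0 => /eqP ->; rewrite mulrCA divff ?mulr1.
Qed.

Theorem proposition1
  (k0 k : fieldType) (char0 : [pchar k0] =i pred0)
  (iota : {rmorphism k0 -> k})
  (tr : k) (tr_transcendental : ~ algebraicOver iota tr)
  (Kbar E Om : diffFieldType)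
  (jK : {rmorphism {fraction {poly k0}} -> Kbar}) (jK_closure : diff_alg_closure jK)
  (jE : {rmorphism Kbar -> E}) (jE_PV : picard_vessiot jE)
  (hE : {rmorphism E -> Om}) (hE_diff : differential hE)
  (hk : {rmorphism {fraction {poly k}} -> Om}) (hk_diff : differential hk)
  (h_compat : forall p : {poly k0}, hE (jE (jK p%:F)) = hk (map_poly iota p)%:F)
  (delay : Om) (delay_neq0 : delay != 0)
  (delay_eq : der delay + hk (tr%:P)%:F * delay = 0)
  (x1 x2 : E)
  (x1_holonomic : holonomic (jE \o jK) x1)
  (x2_holonomic : holonomic (jE \o jK) x2)
  (x1x2_neq0 : x1 * x2 != 0)
  (w1 w2' : diffop {fraction {poly k0}})
  (w1_min : min_annihilator (jE \o jK) w1 x1)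
  (w2'_min : min_annihilator (jE \o jK) w2' (opapp (jE \o jK) w1 x2)) :
  let act := opapp (hE \o jE \o jK) in
  let t := hk (tr%:P)%:F in
  let X := hE x1 + hE x2 * delay in
  exists (n : nat) (pi : 'I_n -> diffop {fraction {poly k0}}),
    [/\ exists nu, pi nu != 0,
        act w2' (act w1 X * delay^-1) = 0 <->
          \sum_(nu < n) t ^+ nu * act (pi nu) X = 0
      & forall Y : Om,
          act w2' (act w1 Y * delay^-1) = 0 <->
            \sum_(nu < n) t ^+ nu * act (pi nu) Y = 0].
Proof.
move=> act t X.
have f_diff : differential (hE \o jE \o jK).
  case: jK_closure => jK_diff _ _; case: jE_PV => jE_diff _ _ x.
  by rewrite /= jK_diff jE_diff hE_diff.
have dt : der t = 0.
  by rewrite /t -hk_diff [der _]ratder_poly derivC tofrac0 rmorph0.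
have de := derV_exp delay_neq0 delay_eq.
case: w1_min => w1_neq0 _; case: w2'_min => w2_neq0 _.
pose pi (nu : 'I_(size w2')) : diffop {fraction {poly k0}} :=
  (w2'^`N(nu) : diffop _) * w1.
have eqv Y : act w2' (act w1 Y * delay^-1) = 0 <->
    \sum_(nu < size w2') t ^+ nu * act (pi nu) Y = 0.
  rewrite /act (opapp_mul_exp _ _ _ dt de).
  under [in X in _ <-> X]eq_bigr => i _ do rewrite opappM //.
  split=> [/eqP|->]; last by rewrite mul0r.
  by rewrite mulf_eq0 invr_eq0 (negPf delay_neq0) orbF => /eqP.
exists (size w2'), pi; split=> //.
have size_w2 : size w2' = (size w2').-1.+1.
  by rewrite prednK // size_poly_gt0.
have lt_ord : ((size w2').-1 < size w2')%N by rewrite -size_w2.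
(* The top coefficient: here the divided derivative of w2' is a constant. *)
exists (Ordinal lt_ord); rewrite /pi /= (nderivn_order size_w2).
rewrite [_ * _]opmul_polyC.
by rewrite scaler_eq0 negb_or lead_coef_eq0; apply/andP.
Qed.
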